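(* Let $A$ be a Banach algebra, let $a,b\in A$, and suppose that $\sigma(a)$ is finite. Then $d(a,b)=0$ if and only if there exist quasinilpotent elements $r_a,r_b\in A$ such that $r_a$ commutes with $a$, $r_b$ commutes with $b$, and $a-b=r_a-r_b$.
   Context: Banach algebras are over $\mathbb{C}$ and have a unit $1$; $\sigma(x)$ is the spectrum of $x\in A$, and $x$ is quasinilpotent if $\sigma(x)=\{0\}$. For $a,b\in A$ let $C_{a,b}:A\to A$ be the bounded operator $C_{a,b}x=ax-xb$, put $\rho(a,b)=\limsup_{n\to\infty}\|C_{a,b}^n1\|^{1/n}$ and $d(a,b)=\max\{\rho(a,b),\rho(b,a)\}$. *)

(* Defs.v *)
From HB Require Import structures.
From mathcomp Require Import all_boot all_order all_algebra.
From mathcomp Require Import all_classical all_reals all_analysis.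
From mathcomp Require Import complex.

Set Implicit Arguments.
Unset Strict Implicit.
Unset Printing Implicit Defensive.

Import Order.TTheory GRing.Theory Num.Theory.
Import numFieldNormedType.Exports.

Local Open Scope classical_set_scope.
Local Open Scope ring_scope.

(* A structure inheriting from both normed modules and rings is rejected by
   Hierarchy-Builder (it would have to be declared below numDomainType).  The
   multiplication is therefore part of the mixin, and the algType structure is
   attached to the carrier afterwards.  `|1| = 1 is not assumed. *)
HB.mixin Record CompleteNormedModule_isBanachAlgebra
    (K : numFieldType) A & CompleteNormedModule K A := {
  ba_one : A;
  ba_mul : A -> A -> A;
  ba_mulA : associative ba_mul;
  ba_mul1x : left_id ba_one ba_mul;
  ba_mulx1 : right_id ba_one ba_mul;
  ba_mulDl : left_distributive ba_mul +%R;
  ba_mulDr : right_distributive ba_mul +%R;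
  ba_one_neq0 : ba_one != 0;
  ba_scaleAl : forall (k : K) (x y : A), k *: ba_mul x y = ba_mul (k *: x) y;
  ba_scaleAr : forall (k : K) (x y : A), k *: ba_mul x y = ba_mul x (k *: y);
  ba_norm_mul_le : forall x y : A, `|ba_mul x y| <= `|x| * `|y|
}.

#[short(type="banachAlgType")]
HB.structure Definition BanachAlgebra (K : numFieldType) :=
  {A of CompleteNormedModule K A & CompleteNormedModule_isBanachAlgebra K A}.

HB.instance Definition _ (K : numFieldType) (A : banachAlgType K) :=
  GRing.Zmodule_isNzRing.Build (BanachAlgebra.sort A)
    ba_mulA ba_mul1x ba_mulx1 ba_mulDl ba_mulDr ba_one_neq0.

HB.instance Definition _ (K : numFieldType) (A : banachAlgType K) :=
  GRing.Lmodule_isLalgebra.Build K (BanachAlgebra.sort A) ba_scaleAl.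

HB.instance Definition _ (K : numFieldType) (A : banachAlgType K) :=
  GRing.Lalgebra_isAlgebra.Build K (BanachAlgebra.sort A) ba_scaleAr.

Lemma norm_mul_le (K : numFieldType) (A : banachAlgType K) (x y : A) :
  `|x * y| <= `|x| * `|y|.
Proof. exact: ba_norm_mul_le. Qed.

Section BanachAlgebraTheory.
Context {R : realType} {A : banachAlgType R[i]}.
Implicit Types (a b x y : A) (l : R[i]).

Definition invertible x := exists y, x * y = 1 /\ y * x = 1.

Definition spectrum x : set R[i] := [set l | ~ invertible (l%:A - x)].

Definition quasinilpotent x := spectrum x = [set 0].

Definition commutator_op a b : A -> A := fun x => a * x - x * b.

(* The norm of a module over R[i] takes its values in the nonnegative reals of
   R[i]; its real part is the norm as an element of R. *)
Definition real_norm x : R := complex.Re `|x|.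

(* The term at n = 0, where n%:R^-1 = 0, does not affect the limsup. *)
Definition local_radius a b : \bar R :=
  limn_esup (fun n : nat =>
    (real_norm (iter n (commutator_op a b) 1) `^ n%:R^-1)%:E).

Definition spectral_dist a b : \bar R :=
  Order.max (local_radius a b) (local_radius b a).

End BanachAlgebraTheory.

(* Main.v *)
Require Import Defs.
From mathcomp Require Import all_boot all_order all_algebra.
From mathcomp Require Import all_classical all_reals all_analysis.
From mathcomp Require Import complex.
From mathcomp Require Import ring lra.
From mathcomp Require Import cyclic separable cyclotomic.

(** Call a sequence superexponentially small when it is [O (e ^ n)] for every
    [e > 0].  Then [d(a, b) = 0] says that the iterated commutators
    [C_{a,b} ^ n 1] and [C_{b,a} ^ n 1] are superexponentially small
    ([spectral_dist_eq0P]), and [x] is quasinilpotent exactly when its powers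
    are ([quasinilpotentP]).  The theorem becomes a statement about decay rates,
    and the binomial sums of decaying sequences that it calls for are estimated
    by a common recursion ([pascal_small]).

    If [a - b = ra - rb], with [ra] commuting with [a] and [rb] with [b], then
    [C_{a,b}] acts on the products [ra ^ j rb ^ k] as [C_{ra,rb}] does, so
    [C_{a,b} ^ n 1] is a binomial sum of such products, and decays as fast as
    the powers of [ra] and [rb] ([commutator_iter_conj]).

    Conversely, a finite spectrum gives [a] a spectral resolution
    [1 = \sum_l P l], in which [(a - l) ^ n P l] is superexponentially small.
    Since [d(a, b) = 0], these decay rates pass to [b] on both sides: both
    [P l (b - l) ^ n] and [(b - l) ^ n P l] are superexponentially small
    ([commutator_small_right], [commutator_small_left]).  Factors attached to
    distinct [l] and [m] then annihilate each other, because [(l - m) ^ n] is a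
    binomial sum in [b - l] and [b - m] ([spectral_separation]).  Hence the
    [P l] are orthogonal idempotents commuting with both [a] and [b], and with
    [c = \sum_l l P l] the elements [a - c] and [b - c] are quasinilpotent
    ([scalar_shift_small]); their difference is [a - b].

    Two analytic facts are obtained without complex integration.

    - If [1 - l x] is invertible for all [l] then the powers of [x] are
      superexponentially small ([superexp_small_expr]).  The mean of
      [(1 - w r x)^-1] over the [n]-th roots of unity [w] is
      [(1 - (r x) ^ n)^-1]; uniform continuity of the resolvent on a disc lets
      the bound [|(r x) ^ n| <= 1] propagate from small [r] to any radius.

    - The resolution of [a] exists ([root_decomposition]).  If [q] has
      simple roots that include the spectrum then [q(a)] is quasinilpotent
      ([finite_spectrum_expr_small]).  For coprime
      [p1] and [p2] with [p1 p2 = q] there are identities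
      [p1 ^ n f n + p2 ^ n g n = 1] whose cofactors grow only exponentially
      ([bezout_powers]).  At [a] the terms [p1 ^ n f n] therefore form a Cauchy
      sequence, and its limit splits off the part of [a] carried by the roots
      of [p2] ([coprime_split]). *)

Set Implicit Arguments.
Unset Strict Implicit.
Unset Printing Implicit Defensive.

Import Order.TTheory GRing.Theory Num.Theory.
Import numFieldNormedType.Exports.

Local Open Scope classical_set_scope.
Local Open Scope ring_scope.

(** * Moduli, norms and invertibility *)

Lemma geometric_lt (R : realType) (e M d : R) :
  0 <= e < 1 -> 0 < d -> exists n, M * e ^+ n < d.
Proof.
move=> /andP[e0 e1] d0.
have [M0|M0] := leP M 0.
  by exists 0%N; rewrite expr0 mulr1 (le_lt_trans M0).
have : (fun n => e ^+ n) @ \oo --> (0:R) by apply: cvg_expr; rewrite ger0_norm.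
move/cvgrPdist_lt => /(_ (d / M) (divr_gt0 d0 M0)) [n _ /(_ n (leqnn n))] /=.
rewrite sub0r normrN ger0_norm ?exprn_ge0 // ltr_pdivlMr // mulrC => h.
by exists n.
Qed.

Section Modulus.
Context {R : realType}.
Implicit Types (l m : R[i]).

Definition cabs l : R := complex.Re `|l|.

Lemma cabsE l : `|l| = (cabs l)%:C%C.
Proof. by rewrite /cabs RRe_real // ger0_real. Qed.

Lemma cabs_ge0 l : 0 <= cabs l.
Proof. by rewrite -lecR -cabsE; apply: normr_ge0. Qed.

Lemma cabsM l m : cabs (l * m) = cabs l * cabs m.
Proof. by apply: (@complexI R); rewrite rmorphM /= -!cabsE normrM. Qed.

Lemma cabsD l m : cabs (l + m) <= cabs l + cabs m.
Proof. by rewrite -lecR rmorphD /= -!cabsE ler_normD. Qed.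

Lemma cabsX l n : cabs (l ^+ n) = cabs l ^+ n.
Proof. by apply: (@complexI R); rewrite rmorphXn /= -!cabsE normrX. Qed.

Lemma cabs_real (r : R) : cabs r%:C%C = `|r|.
Proof.
apply: (@complexI R); rewrite -cabsE normc_def /= expr0n addr0.
by rewrite sqrtr_sqr.
Qed.

Lemma cabs_gt0 l : l != 0 -> 0 < cabs l.
Proof. by rewrite -normr_gt0 cabsE ltcR. Qed.

Lemma Re_le_cabs l : `|complex.Re l| <= cabs l.
Proof. by rewrite -lecR -cabsE normc_ge_Re. Qed.

Lemma Im_le_cabs l : `|complex.Im l| <= cabs l.
Proof.
have -> : cabs l = cabs (l * (Complex 0 (-1))).
  rewrite cabsM.
  have -> : cabs (Complex 0 (-1) : R[i]) = 1.
    by rewrite /cabs normc_def /= expr0n add0r sqrtr_sqr normrN1.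
  by rewrite mulr1.
apply: le_trans (Re_le_cabs _); case: l => s t /=.
by rewrite mulr0 mulrN1 opprK add0r.
Qed.

Lemma cabs_le_ReIm l : cabs l <= `|complex.Re l| + `|complex.Im l|.
Proof.
have -> : l = (complex.Re l)%:C%C + Complex 0 (complex.Im l).
  by case: l => s t; apply/eqP; rewrite eq_complex /= addr0 add0r !eqxx.
apply: le_trans (cabsD _ _) _; rewrite /= addr0 add0r cabs_real lerD2l.
by rewrite /cabs normc_def /= expr0n add0r sqrtr_sqr.
Qed.

End Modulus.

Section RealNorm.
Context {R : realType} {A : banachAlgType R[i]}.
Implicit Types (x y z : A) (l : R[i]).

Lemma norm_real_normE x : `|x| = (real_norm x)%:C%C.
Proof. by rewrite /real_norm RRe_real // ger0_real. Qed.

Lemma real_norm_ge0 x : 0 <= real_norm x.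
Proof. by rewrite -lecR -norm_real_normE; apply: normr_ge0. Qed.

Lemma real_normD x y : real_norm (x + y) <= real_norm x + real_norm y.
Proof. by rewrite -lecR rmorphD /= -!norm_real_normE ler_normD. Qed.

Lemma real_normN x : real_norm (- x) = real_norm x.
Proof. by rewrite /real_norm normrN. Qed.

Lemma real_normB x y : real_norm (x - y) <= real_norm x + real_norm y.
Proof. by rewrite -(real_normN y) real_normD. Qed.

Lemma real_norm_distC x y : real_norm (x - y) = real_norm (y - x).
Proof. by rewrite /real_norm distrC. Qed.

Lemma real_normM x y : real_norm (x * y) <= real_norm x * real_norm y.
Proof. by rewrite -lecR rmorphM /= -!norm_real_normE norm_mul_le. Qed.

Lemma real_norm0 : real_norm (0 : A) = 0.
Proof. by rewrite /real_norm normr0. Qed.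

Lemma real_norm_eq0 x : real_norm x = 0 -> x = 0.
Proof. by move=> x0; apply/eqP; rewrite -normr_eq0 norm_real_normE x0. Qed.

Lemma real_norm_scale l x :
  real_norm (l *: x) = cabs l * real_norm x.
Proof.
by apply: (@complexI R); rewrite rmorphM /= -!norm_real_normE -cabsE normrZ.
Qed.

Lemma real_normX x n : real_norm (x ^+ n.+1) <= real_norm x ^+ n.+1.
Proof.
elim: n => [|n IH]; first by rewrite !expr1.
rewrite exprS (exprS _ n.+1); apply: le_trans (real_normM _ _) _.
exact: ler_wpM2l (real_norm_ge0 _) _ _ IH.
Qed.

Lemma real_norm_sum I (r : seq I) (F : I -> A) :
  real_norm (\sum_(i <- r) F i) <= \sum_(i <- r) real_norm (F i).
Proof.
elim/big_rec2: _ => [|i u v _ IH]; first by rewrite real_norm0.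
by apply: le_trans (real_normD _ _) _; rewrite lerD2l.
Qed.

End RealNorm.

Section Invertible.
Context {R : realType} {A : banachAlgType R[i]}.
Implicit Types (x y : A) (l : R[i]).

Lemma invertible1 : invertible (1 : A).
Proof. by exists 1; rewrite mulr1. Qed.

Lemma invertibleM x y : invertible x -> invertible y -> invertible (x * y).
Proof.
move=> [x' [xx' x'x]] [y' [yy' y'y]]; exists (y' * x'); split.
  by rewrite mulrA -(mulrA x) yy' mulr1.
by rewrite mulrA -(mulrA y') x'x mulr1.
Qed.

Lemma invertibleN x : invertible x -> invertible (- x).
Proof. by move=> [y [xy yx]]; exists (- y); rewrite !mulrNN. Qed.

Lemma scalar_sub_factor l x : l != 0 -> l%:A - x = l *: (1 - l^-1 *: x).
Proof. by move=> l0; rewrite scalerBr scalerA mulfV // scale1r. Qed.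

Lemma invertibleZ l x : l != 0 -> invertible x -> invertible (l *: x).
Proof.
move=> l0 [y [xy yx]]; exists (l^-1 *: y).
by rewrite -!scalerAl -!scalerAr !scalerA xy yx mulfV // mulVf // scale1r.
Qed.

End Invertible.

(** * Superexponentially small sequences *)

Section SuperexpSmall.
Context {R : realType} {A : banachAlgType R[i]}.
Implicit Types (s t : nat -> A) (x y z : A).

Definition superexp_small s :=
  forall e : R, 0 < e -> exists M, forall n, real_norm (s n) <= M * e ^+ n.

Lemma superexp_small_eq s t :
  s =1 t -> superexp_small s -> superexp_small t.
Proof.
by move=> st hs e /hs[M hM]; exists M => n; rewrite -st.
Qed.

Lemma superexp_smallD s t :
  superexp_small s -> superexp_small t -> superexp_small (fun n => s n + t n).
Proof.
move=> hs ht e e0; have [M hM] := hs e e0; have [L hL] := ht e e0.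
exists (M + L) => n; rewrite mulrDl; apply: le_trans (real_normD _ _) _.
exact: lerD.
Qed.

Lemma superexp_small_sum I (r : seq I) (s : I -> nat -> A) :
  (forall i, superexp_small (s i)) ->
  superexp_small (fun n => \sum_(i <- r) s i n).
Proof.
move=> hs; elim: r => [|i r IH].
  move=> e e0; exists 0 => n; rewrite big_nil real_norm0 mul0r//.
apply: superexp_small_eq (superexp_smallD (hs i) IH) => n.
by rewrite big_cons.
Qed.

(** Exponential factors are absorbed because the rate [e] is arbitrary: the
    bound for [t] at rate [e] is the one for [s] at rate [e / K]. *)
Lemma superexp_small_dom s t (C K : R) : 0 <= C -> 0 < K ->
  (forall n, real_norm (t n) <= C * K ^+ n * real_norm (s n)) ->
  superexp_small s -> superexp_small t.
Proof.
move=> C0 K0 hst hs e e0; have [M hM] := hs (e / K) (divr_gt0 e0 K0).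
exists (C * M) => n; apply: le_trans (hst n) _.
have -> : C * M * e ^+ n = C * K ^+ n * (M * (e / K) ^+ n).
  by rewrite expr_div_n; field; rewrite expf_neq0 // gt_eqF.
by apply: ler_wpM2l (hM n); rewrite mulr_ge0 // exprn_ge0 // ltW.
Qed.

Lemma superexp_smallN s :
  superexp_small s -> superexp_small (fun n => - s n).
Proof.
apply: (@superexp_small_dom _ _ 1 1) => // n.
by rewrite real_normN expr1n !mul1r.
Qed.

Lemma real_normMX x y n :
  real_norm (x ^+ n * y) <= (real_norm x + 1) ^+ n * real_norm y.
Proof.
elim: n => [|n IH]; first by rewrite !expr0 !mul1r.
rewrite !exprS -!mulrA; apply: le_trans (real_normM _ _) _.
apply: ler_pM => //; rewrite ?real_norm_ge0 //.
by rewrite lerDl.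
Qed.

Lemma superexp_small_exprM x s :
  superexp_small s -> superexp_small (fun n => x ^+ n * s n).
Proof.
have K0 : 0 < real_norm x + 1 by rewrite ltr_wpDl ?real_norm_ge0.
apply: (superexp_small_dom ler01 K0) => n.
by rewrite mul1r; apply: real_normMX.
Qed.

Lemma superexp_smallMl x s :
  superexp_small s -> superexp_small (fun n => x * s n).
Proof.
apply: (superexp_small_dom (real_norm_ge0 x) ltr01) => n.
by rewrite expr1n mulr1 real_normM.
Qed.

Lemma superexp_smallMr x s :
  superexp_small s -> superexp_small (fun n => s n * x).
Proof.
apply: (superexp_small_dom (real_norm_ge0 x) ltr01) => n.
by rewrite expr1n mulr1 mulrC real_normM.
Qed.

(** No geometric lower bound survives superexponential decay, however small its
    ratio.  This is what turns estimates into exact identities below. *)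
Lemma superexp_small_eq0 s x (k : R) : 0 < k ->
  (forall n, k ^+ n * real_norm x <= real_norm (s n)) ->
  superexp_small s -> x = 0.
Proof.
move=> k0 hx hs; apply: real_norm_eq0; apply/eqP.
rewrite eq_le real_norm_ge0 andbT leNgt; apply/negP => x0.
have k20 : 0 < k / 2 by rewrite divr_gt0.
have [M hM] := hs _ k20.
have [n] := @geometric_lt R (1 / 2) M (real_norm x) ltac:(by lra) x0.
apply/negP; rewrite -leNgt.
have kn : 0 < k ^+ n by rewrite exprn_gt0.
rewrite -(ler_pM2l kn); apply: le_trans (hx n) _; apply: le_trans (hM n) _.
by rewrite mul1r !exprMn mulrCA.
Qed.

Lemma superexp_small_cst x : superexp_small (fun=> x) -> x = 0.
Proof.
by apply: (@superexp_small_eq0 _ _ 1) => // n; rewrite expr1n mul1r.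
Qed.

(** Unfolding the recursion bounds the norm of [s j k m] by the sum of [2 ^ m]
    norms of values [s j' k' 0] with [j' + k' = j + k + m], and each of them
    decays at rate [e / 2].  Stating the recursion through norms covers
    binomial expansions of sums and of differences alike, without binomial
    coefficients. *)
Lemma pascal_small (s : nat -> nat -> nat -> A) (u v : nat -> A) (C : R) :
  (forall j k m, real_norm (s j k m.+1) <=
     real_norm (s j.+1 k m) + real_norm (s j k.+1 m)) ->
  (forall j k, real_norm (s j k 0) <= C * real_norm (u j) * real_norm (v k)) ->
  superexp_small u -> superexp_small v -> superexp_small (s 0 0).
Proof.
move=> srec s0 hu hv e e0.
have e2 : 0 < e / 2 by rewrite divr_gt0.
have [M hM] := hu _ e2; have [L hL] := hv _ e2.
have bnd m : forall j k,
    real_norm (s j k m) <= `|C| * M * L * 2 ^+ m * (e / 2) ^+ (j + k + m).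
  elim: m => [|m IH] j k.
    apply: le_trans (s0 j k) _; rewrite expr0 mulr1 addn0 exprD.
    apply: (@le_trans _ _ (`|C| * real_norm (u j) * real_norm (v k))).
      by rewrite -!mulrA ler_wpM2r ?mulr_ge0 ?real_norm_ge0 // ler_norm.
    have -> : `|C| * M * L * ((e / 2) ^+ j * (e / 2) ^+ k) =
      `|C| * (M * (e / 2) ^+ j) * (L * (e / 2) ^+ k) by ring.
    by rewrite !ler_pM ?mulr_ge0 ?real_norm_ge0.
  apply: le_trans (srec j k m) _; apply: le_trans (lerD (IH _ _) (IH _ _)) _.
  rewrite !(addSn, addnS) (exprS 2) le_eqVlt; apply/orP; left; apply/eqP.
  by ring.
exists (`|C| * M * L) => m; apply: le_trans (bnd m 0 0)%N _.
rewrite add0n expr_div_n -mulrA.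
by rewrite [2 ^+ m * _]mulrC divfK // expf_neq0.
Qed.

(** The constant can be traded for finitely many exceptional indices; this is
    the form in which a vanishing limit superior is read. *)
Lemma superexp_smallP s : superexp_small s <->
  forall e : R, 0 < e ->
    exists n0, forall n, (n0 <= n)%N -> real_norm (s n) <= e ^+ n.
Proof.
split=> [hs e e0|hs e e0].
  have e20 : 0 < e / 2 by rewrite divr_gt0.
  have [M hM] := hs _ e20.
  have [n0 hn0] := @geometric_lt R (1 / 2) `|M| 1 ltac:(by lra) ltr01.
  exists n0 => n n0n; apply: le_trans (hM n) _.
  have -> : M * (e / 2) ^+ n = M * (1 / 2) ^+ n * e ^+ n.
    by rewrite -mulrA -exprMn; congr (_ * _ ^+ _); field.
  rewrite -[leRHS]mul1r ler_wpM2r ?exprn_ge0 ?(ltW e0) //.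
  apply: (le_trans _ (ltW hn0)); apply: (@le_trans _ _ (`|M| * (1 / 2) ^+ n)).
    by rewrite ler_wpM2r ?ler_norm // exprn_ge0 //; lra.
  by rewrite ler_wpM2l // ler_wiXn2l //; lra.
have [n0 hn0] := hs _ e0.
exists (1 + \sum_(i < n0) real_norm (s i) / e ^+ i) => n.
have en : 0 < e ^+ n by rewrite exprn_gt0.
have pos (i : 'I_n0) : 0 <= real_norm (s i) / e ^+ i.
  by rewrite divr_ge0 ?real_norm_ge0 // exprn_ge0 // ltW.
have [/hn0 h|nn0] := leqP n0 n.
  apply: le_trans h _; rewrite -[leLHS]mul1r ler_wpM2r ?(ltW en) // lerDl.
  exact: sumr_ge0.
rewrite -ler_pdivrMr // (bigD1 (Ordinal nn0)) //= addrCA lerDl addr_ge0 //.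
exact: sumr_ge0.
Qed.

End SuperexpSmall.

(** * Roots of unity *)

Section RootsOfUnity.
Context {R : realType}.

Lemma prim_root_exists n : (0 < n)%N ->
  exists w : R[i], n.-primitive_root w.
Proof.
move=> n_gt0; pose p : {poly R[i]} := 'X^n - 1.
have [r Dp] := closed_field_poly_normal p.
rewrite (monicP _) ?monicXnsubC // scale1r in Dp.
have rn1 : all n.-unity_root r.
  by apply/allP => z; rewrite -root_prod_XsubC -Dp.
have sz_r : (n < (size r).+1)%N.
  by rewrite -(size_prod_XsubC r id) -Dp size_XnsubC.
have [|z] := hasP (has_prim_root n_gt0 rn1 _ sz_r); last by exists z.
by rewrite -separable_prod_XsubC -Dp separable_Xn_sub_1 // pnatr_eq0 -lt0n.
Qed.

Lemma cabs_prim_root n (w : R[i]) : n.-primitive_root w -> cabs w = 1.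
Proof.
move=> wn; have n0 := prim_order_gt0 wn; apply/eqP.
rewrite -(pexpr_eq1 n0) ?cabs_ge0 // -cabsX (prim_expr_order wn).
by rewrite /cabs normr1.
Qed.

Lemma sum_prim_root_expr n (w : R[i]) k : n.-primitive_root w -> (k < n)%N ->
  \sum_(j < n) (w ^+ j) ^+ k = if k == 0%N then n%:R else 0.
Proof.
move=> wn kn; case: eqP => [->|/eqP k0].
  by under eq_bigr do rewrite expr0; rewrite sumr_const card_ord.
have wk : w ^+ k != 1.
  by rewrite -(prim_order_dvd wn) gtnNdvd // lt0n.
apply: (mulfI (_ : w ^+ k - 1 != 0)); first by rewrite subr_eq0.
under eq_bigr do rewrite -exprM mulnC exprM.
by rewrite -subrX1 mulr0 -exprM mulnC exprM (prim_expr_order wn) expr1n subrr.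
Qed.

End RootsOfUnity.

(** * The resolvent and the spectral radius *)

Section Resolvent.
Context {R : realType} {A : banachAlgType R[i]}.
Context (x : A) (Rs : R[i] -> A).
Context (Rsl : forall l, Rs l * (1 - l *: x) = 1).
Context (Rsr : forall l, (1 - l *: x) * Rs l = 1).

Lemma resolvent_eq l m : Rs l - Rs m = (l - m) *: (Rs l * x * Rs m).
Proof.
transitivity (Rs l * ((1 - m *: x) - (1 - l *: x)) * Rs m).
  by rewrite mulrBr mulrBl Rsl mul1r -mulrA Rsr mulr1.
have -> : 1 - m *: x - (1 - l *: x) = (l - m) *: x.
  by rewrite scalerBl opprB addrC addrA subrK.
by rewrite -scalerAr -scalerAl.
Qed.

Lemma resolvent_dist l m : real_norm (Rs l - Rs m) <=
  cabs (l - m) * (real_norm (Rs l) * real_norm x * real_norm (Rs m)).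
Proof.
rewrite resolvent_eq real_norm_scale ler_wpM2l ?cabs_ge0 //.
apply: le_trans (real_normM _ _) _; rewrite ler_wpM2r ?real_norm_ge0 //.
exact: real_normM.
Qed.

(** Invertibility near [l] being given, the resolvent identity
    [|Rs m| <= |Rs l| + |l - m| |Rs l| |x| |Rs m|] bounds [Rs m] as soon as the
    coefficient of [|Rs m|] on the right is at most [1 / 2]. *)
Lemma resolvent_locally_bounded l : exists2 d : R, 0 < d &
  forall m, cabs (l - m) < d -> real_norm (Rs m) <= 2 * real_norm (Rs l).
Proof.
pose c := real_norm (Rs l) * real_norm x + 1.
have c0 : 0 < c by rewrite ltr_wpDl // mulr_ge0 // real_norm_ge0.
exists (2 * c)^-1; first by rewrite invr_gt0 mulr_gt0.
move=> m; rewrite -[X in _ < X]div1r ltr_pdivlMr ?mulr_gt0 // => lm.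
have h : real_norm (Rs m) <= real_norm (Rs l) + real_norm (Rs l - Rs m).
  by rewrite real_norm_distC -{1}(subrKC (Rs l) (Rs m)) real_normD.
have := resolvent_dist l m.
set u := cabs _ in lm *; set p := real_norm (Rs l) in c c0 lm h *.
set q := real_norm (Rs m) in h *; set y := real_norm x in c c0 lm *.
have q0 : 0 <= q := real_norm_ge0 _; have u0 : 0 <= u := cabs_ge0 _.
move: (real_norm (_ - _)) h => v h1 h2.
have : u * (p * y) * q <= (1 / 2) * q.
  by rewrite ler_wpM2r //; rewrite /c in lm; nra.
rewrite -!mulrA in h2 *; lra.
Qed.

(** Local boundedness becomes a global bound by compactness of the square
    [[- rho, rho]^2] of real and imaginary parts, which contains the disc. *)
Lemma resolvent_bounded (rho : R) : exists2 K : R, 0 < K &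
  forall l, cabs l <= rho -> real_norm (Rs l) <= K.
Proof.
have : compact ((`[- rho, rho] : set R) `*` (`[- rho, rho] : set R)).
  by apply: compact_setX; apply: segment_compact.
move=> /compact_near_coveringP /(_ R +oo%R
  (fun M p => real_norm (Rs (Complex p.1 p.2)) <= M)) => /(_ _)[].
  move=> [s t] _ /=.
  have [d d0 hd] := resolvent_locally_bounded (Complex s t).
  have d20 : 0 < d / 2 by rewrite divr_gt0.
  exists (ball (s, t) (d / 2), [set M | 2 * real_norm (Rs (Complex s t)) <= M]).
    split => /=; first exact: nbhsx_ballx.
    by apply: nbhs_pinfty_ge; rewrite num_real.
  move=> [[s' t'] M] /= [[]]; rewrite -!ball_normE /= => hs ht.
  apply: le_trans; apply: hd; apply: le_lt_trans (cabs_le_ReIm _) _ => /=.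
  rewrite [X in _ < X](splitr d); exact: ltrD.
move=> M [_ hM].
exists (`|M| + 1); first by rewrite ltr_wpDl.
move=> [s t] st; apply: (hM _ _ (s, t)).
  by rewrite (le_lt_trans (ler_norm M)) // ltrDl.
have := Re_le_cabs (Complex s t); have := Im_le_cabs (Complex s t) => /=.
move=> /le_trans /(_ st); rewrite ler_norml => ht.
move=> /le_trans /(_ st); rewrite ler_norml => hs.
by split; rewrite /= in_itv.
Qed.

(** A Riemann sum of the Cauchy integral of the resolvent over the circle of
    radius [r]; unlike the integral it is computed exactly, below. *)
Definition resolvent_mean n (w r : R[i]) :=
  n%:R^-1 *: \sum_(j < n) Rs (w ^+ j * r).

(** Multiplied by [1 - (r x) ^ n], each term of the mean becomes the finite
    geometric sum [\sum_(k < n) (w ^ j r x) ^ k], and the average over [j]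
    cancels all its terms except the one at [k = 0]. *)
Lemma resolvent_meanP n (w r : R[i]) : n.-primitive_root w ->
  resolvent_mean n w r * (1 - r ^+ n *: x ^+ n) = 1.
Proof.
move=> wn; have n0 := prim_order_gt0 wn.
have term (j : 'I_n) : Rs (w ^+ j * r) * (1 - r ^+ n *: x ^+ n) =
    \sum_(k < n) (w ^+ j) ^+ k *: (r ^+ k *: x ^+ k).
  have -> : r ^+ n *: x ^+ n = ((w ^+ j * r) *: x) ^+ n.
    rewrite exprZn exprMn -exprM mulnC exprM (prim_expr_order wn).
    by rewrite expr1n mul1r.
  have -> : 1 - ((w ^+ j * r) *: x) ^+ n =
      (1 - (w ^+ j * r) *: x) * \sum_(k < n) ((w ^+ j * r) *: x) ^+ k.
    by rewrite -opprB subrX1 -mulNr opprB.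
  rewrite mulrA Rsl mul1r; apply: eq_bigr => k _.
  by rewrite exprZn exprMn scalerA.
rewrite /resolvent_mean -scalerAl mulr_suml (eq_bigr _ (fun j _ => term j)).
rewrite exchange_big /=.
under eq_bigr do rewrite -scaler_suml sum_prim_root_expr //.
rewrite (bigD1 (Ordinal n0)) //= big1 ?addr0; last first.
  by move=> k; rewrite -val_eqE /= => /negbTE ->; rewrite scale0r.
by rewrite !expr0 scale1r scalerA mulVf ?scale1r // pnatr_eq0 -lt0n.
Qed.

Lemma real_norm_mean n (F : 'I_n -> A) (K : R) : (0 < n)%N ->
  (forall j, real_norm (F j) <= K) ->
  real_norm ((n%:R : R[i])^-1 *: \sum_j F j) <= K.
Proof.
move=> n0 hF; rewrite real_norm_scale.
have -> : cabs (n%:R : R[i])^-1 = n%:R^-1.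
  have -> : (n%:R : R[i])^-1 = (n%:R^-1)%:C%C by rewrite fmorphV /= rmorph_nat.
  by rewrite cabs_real ger0_norm.
rewrite mulrC ler_pdivrMr ?ltr0n //.
apply: le_trans (real_norm_sum _ _) _; apply: le_trans (ler_sum _ _) _.
  by move=> j _; apply: hF.
by rewrite sumr_const card_ord mulr_natr.
Qed.

(** If [(r1 x) ^ n] is small then the mean [f1], which inverts [1 - (r1 x) ^ n],
    is close to [1].  The bound [K] on the resolvent makes it Lipschitz on the
    disc, so the mean [f2] at the larger radius [r2] is still close to [1], and
    this bounds [(r2 x) ^ n].  The admissible gain [r2 - r1] depends on the disc
    only, neither on [n] nor on [r1]. *)
Lemma radius_step (rho K r1 r2 : R) n :
  (forall l, cabs l <= rho -> real_norm (Rs l) <= K) ->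
  (0 < n)%N -> 0 <= r1 <= r2 -> r2 <= rho ->
  (r2 - r1) * (K * real_norm x * K) <= 1 / 4 ->
  K * real_norm ((r1%:C%C : R[i]) ^+ n *: x ^+ n) <= 1 / 4 ->
  real_norm ((r2%:C%C : R[i]) ^+ n *: x ^+ n) <= 1.
Proof.
move=> hK n0 /andP[r10 r12] r2rho hd hy.
have [w wn] := @prim_root_exists R n n0.
have cw (j : nat) (r : R) : 0 <= r -> cabs (w ^+ j * r%:C%C) = r.
  move=> r0; rewrite cabsM cabsX (cabs_prim_root wn) expr1n mul1r cabs_real.
  by rewrite ger0_norm.
have r20 : 0 <= r2 := le_trans r10 r12.
have hK1 j : real_norm (Rs (w ^+ j * r1%:C%C)) <= K.
  by apply: hK; rewrite cw // (le_trans r12).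
have hK2 j : real_norm (Rs (w ^+ j * r2%:C%C)) <= K.
  by apply: hK; rewrite cw.
pose f1 := resolvent_mean n w r1%:C%C; pose f2 := resolvent_mean n w r2%:C%C.
have f1K : real_norm f1 <= K by apply: real_norm_mean.
have f12 : real_norm (f2 - f1) <= 1 / 4.
  rewrite /f2 /f1 /resolvent_mean -scalerBr -sumrB; apply: real_norm_mean => // j.
  apply: le_trans (resolvent_dist _ _) _; apply: le_trans hd.
  rewrite -mulrBr -rmorphB cw ?subr_ge0 // ler_wpM2l ?subr_ge0 //.
  rewrite !ler_pM ?mulr_ge0 ?real_norm_ge0 //.
have f11 : real_norm (f1 - 1) <= 1 / 4.
  have -> : f1 - 1 = f1 * (r1%:C%C ^+ n *: x ^+ n).
    by rewrite -[X in _ - X](@resolvent_meanP n w r1%:C%C) // mulrBr mulr1 subKr.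
  apply: le_trans (real_normM _ _) _; apply: le_trans hy.
  by rewrite ler_wpM2r ?real_norm_ge0.
have f21 : real_norm (f2 - 1) <= 1 / 2.
  rewrite -(subrK f1 f2) -addrA; apply: le_trans (real_normD _ _) _; lra.
set y := _ *: _.
have yE : y = (f2 - 1) - (f2 - 1) * y.
  rewrite mulrBl mul1r -{1}(@resolvent_meanP n w r2%:C%C) // mulrBr mulr1.
  by rewrite -/y subKr subKr.
have : real_norm y <= 1 / 2 + 1 / 2 * real_norm y.
  rewrite {1}yE; apply: le_trans (real_normB _ _) _; apply: lerD => //.
  apply: le_trans (real_normM _ _) _; rewrite ler_wpM2r ?real_norm_ge0 //.
by lra.
Qed.

End Resolvent.

Section SpectralRadius.
Context {R : realType} {A : banachAlgType R[i]}.
Implicit Types (s z : nat -> A) (x y : A).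

(** The property [S r], that [|(r x) ^ n| <= 1] for large [n], holds at small
    radii by submultiplicativity.  It passes from [r] to [r + d] by stepping
    back to [r - d], where [(r x) ^ n] being bounded makes [((r - d) x) ^ n]
    tend to zero, and applying [radius_step] between [r - d] and [r + d].  The
    step [d] is fixed by the bound on the disc of radius [rho = 1 / e], so [rho]
    is reached after finitely many steps. *)
Lemma superexp_small_expr x :
  (forall l, invertible (1 - l *: x)) -> superexp_small (fun n => x ^+ n).
Proof.
move=> inv; have [Rs hRs] := choice inv.
have Rsr l : (1 - l *: x) * Rs l = 1 by have [] := hRs l.
have Rsl l : Rs l * (1 - l *: x) = 1 by have [] := hRs l.
apply/superexp_smallP => e e0; pose rho := e^-1.
have rho0 : 0 < rho by rewrite invr_gt0.
have [K K0 hK] := resolvent_bounded Rsl Rsr rho.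
pose S r := exists n0, forall n, (n0 <= n)%N -> r ^+ n * real_norm (x ^+ n) <= 1.
suff [n0 hn0] : S rho.
  exists n0 => n /hn0; rewrite /rho exprVn mulrC ler_pdivrMr ?exprn_gt0 //.
  by rewrite mul1r.
pose N := real_norm x; have N0 : 0 <= N := real_norm_ge0 x.
pose r0 := Num.min (N + 1)^-1 rho.
have r00 : 0 < r0 by rewrite lt_min invr_gt0 ltr_wpDl //= rho0.
(* [radius_step] is used across a gap of [2 d]: this gives [2 d K N K <= 1 / 4]. *)
pose c := 8 * (K * N * K + 1).
have c0 : 0 < c by rewrite mulr_gt0 // ltr_wpDl // !mulr_ge0 // ltW.
pose d := Num.min r0 c^-1.
have d0 : 0 < d by rewrite lt_min r00 invr_gt0 c0.
have dr0 : d <= r0 by rewrite ge_min lexx.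
have dK : 2 * d * (K * N * K) <= 1 / 4.
  have : d <= c^-1 by rewrite ge_min lexx orbT.
  rewrite -[c^-1]div1r ler_pdivlMr // /c => h; nra.
have S0 : S r0.
  exists 1%N => -[|n] // _.
  apply: (@le_trans _ _ ((N + 1)^-1 ^+ n.+1 * (N + 1) ^+ n.+1)).
    rewrite ler_pM ?real_norm_ge0 ?exprn_ge0 ?(ltW r00) //.
      by rewrite lerXn2r ?nnegrE ?(ltW r00) ?invr_ge0 ?addr_ge0 // ge_min lexx.
    apply: le_trans (real_normX _ _) _.
    by rewrite lerXn2r ?nnegrE ?addr_ge0 // lerDl.
  by rewrite -exprMn mulVf ?expr1n // gt_eqF // ltr_wpDl.
have step r : r0 <= r <= rho -> S r -> S (Num.min (r + d) rho).
  move=> /andP[r0r rrho] [n1 hn1].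
  have r_gt0 : 0 < r := lt_le_trans r00 r0r.
  have dr : d <= r := le_trans dr0 r0r.
  have q01 : 0 <= (r - d) / r < 1.
    by rewrite divr_ge0 ?subr_ge0 ?(ltW r_gt0) //= ltr_pdivrMr // mul1r ltrBlDr ltrDl.
  have [n2 hn2] := @geometric_lt R ((r - d) / r) K (1 / 4) q01 ltac:(by lra).
  exists (maxn 1 (maxn n1 n2)) => n; rewrite !geq_max => /and3P[n_gt0 nn1 nn2].
  set r2 := Num.min _ _.
  have r20 : 0 <= r2 by rewrite le_min addr_ge0 ?(ltW rho0) // ltW.
  have cE (q : R) : 0 <= q -> real_norm ((q%:C%C : R[i]) ^+ n *: x ^+ n) =
      q ^+ n * real_norm (x ^+ n).
    by move=> q0; rewrite real_norm_scale cabsX cabs_real ger0_norm.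
  rewrite -cE //; apply: (radius_step Rsl Rsr (r1 := r - d) hK n_gt0).
  - by rewrite subr_ge0 dr le_min; apply/andP; split; lra.
  - by rewrite /r2 ge_min lexx orbT.
  - apply: le_trans dK; rewrite ler_wpM2r ?mulr_ge0 ?(ltW K0) //.
    by rewrite lerBlDr /r2 ge_min; apply/orP; left; lra.
  - rewrite cE ?subr_ge0 //; apply: le_trans (ltW hn2).
    rewrite ler_wpM2l ?(ltW K0) //.
    apply: (@le_trans _ _ (((r - d) / r) ^+ n)); last first.
      by case/andP: q01 => q0 q1; rewrite ler_wiXn2l // ltW.
    rewrite expr_div_n ler_pdivlMr ?exprn_gt0 // -mulrA.
    rewrite -[leRHS]mulr1 ler_wpM2l ?exprn_ge0 ?subr_ge0 // mulrC.
    exact: hn1.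
have reach k : S (Num.min (r0 + k%:R * d) rho).
  elim: k => [|k IH].
    by rewrite mul0r addr0 /r0 -minA minxx.
  have rk : r0 <= Num.min (r0 + k%:R * d) rho <= rho.
    apply/andP; split; last by rewrite ge_min lexx orbT.
    rewrite le_min lerDl mulr_ge0 ?(ltW d0) //=.
    by rewrite /r0 ge_min lexx orbT.
  have := step _ rk IH.
  have -> //: Num.min (Num.min (r0 + k%:R * d) rho + d) rho =
    Num.min (r0 + k.+1%:R * d) rho.
  rewrite addr_minl -minA -addrA -natr1 mulrDl mul1r; congr Num.min.
  by apply/min_idPr; rewrite lerDl ltW.
have := reach (Num.bound (rho / d)).
suff -> : Num.min (r0 + (Num.bound (rho / d))%:R * d) rho = rho by [].
apply/min_idPr; rewrite -[leLHS]add0r lerD ?(ltW r00) //.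
by rewrite -ler_pdivrMr // ltW // archi_boundP // divr_ge0 // ltW.
Qed.

(** Completeness, with the rate of convergence: if the differences are bounded
    by [M e ^ n] with [e <= 1 / 2], the tails of the telescoping series are
    bounded by [2 M e ^ n]. *)
Lemma superexp_small_lim z : superexp_small (fun n => z n.+1 - z n) ->
  exists l, superexp_small (fun n => l - z n).
Proof.
move=> hz.
have tail (e : R) : 0 < e <= 1 / 2 -> exists2 M, 0 <= M &
    forall n k, real_norm (z (n + k)%N - z n) <= M * e ^+ n.
  move=> /andP[e0 e12]; have [M hM] := hz _ e0.
  have M0 : 0 <= M.
    by have := hM 0%N; rewrite expr0 mulr1; apply: le_trans; apply: real_norm_ge0.
  exists (2 * M) => [|n k]; first by rewrite mulr_ge0.
  suff : real_norm (z (n + k)%N - z n) <= 2 * M * e ^+ n - 2 * M * e ^+ (n + k).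
    move=> h; apply: le_trans h _; rewrite gerBl !mulr_ge0 // exprn_ge0 // ltW //.
  elim: k => [|k IH]; first by rewrite addn0 !subrr real_norm0.
  rewrite addnS -(subrK (z (n + k)%N) (z (n + k).+1)) -addrA.
  apply: le_trans (real_normD _ _) _; have := hM (n + k)%N.
  rewrite exprS; set p := e ^+ (n + k) in IH * => h.
  have p0 : 0 <= p by rewrite exprn_ge0 // ltW.
  have : e * (M * p) <= 1 / 2 * (M * p) by rewrite ler_wpM2r // mulr_ge0.
  lra.
have half : 0 < (1 / 2 : R) <= 1 / 2 by lra.
have : cvg (z @ \oo).
  apply/cauchy_cvgP; apply: cauchy_exP => eps eps0.
  have [M M0 hM] := tail _ half.
  have epsE : eps = (complex.Re eps)%:C%C by rewrite RRe_real // gtr0_real.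
  have re0 : 0 < complex.Re eps by rewrite -ltcR -epsE.
  have [n hn] := @geometric_lt R (1 / 2) M _ ltac:(by lra) re0.
  exists (z n), n => // m /= nm; rewrite -ball_normE /= epsE norm_real_normE ltcR.
  by rewrite -(subnKC nm) real_norm_distC; apply: le_lt_trans hn.
move=> /cvg_ex[l zl]; exists l => e e0.
have m0 : 0 < Num.min e (1 / 2) <= 1 / 2.
  by rewrite lt_min e0 ge_min lexx orbT andbT; lra.
have [M M0 hM] := tail _ m0.
exists M => n; apply: (@le_trans _ _ (M * Num.min e (1 / 2) ^+ n)); last first.
  case/andP: m0 => m0 _; rewrite ler_wpM2l // lerXn2r ?nnegrE ?(ltW m0) ?(ltW e0) //.
  by rewrite ge_min lexx.
apply/ler_addgt0Pl => d d0.
have dC : 0 < d%:C%C :> R[i] by rewrite ltcR.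
move/cvgrPdist_lt: zl => /(_ _ dC)[m _ /(_ (n + m)%N)] /= /(_ (leq_addl _ _)).
rewrite norm_real_normE ltcR => h.
have -> : l - z n = (l - z (n + m)%N) + (z (n + m)%N - z n) by rewrite addrA subrK.
by apply: le_trans (real_normD _ _) _; apply: lerD (hM _ _); apply: ltW.
Qed.

Lemma superexp_smallZX l x :
  superexp_small (fun n => x ^+ n) -> superexp_small (fun n => (l *: x) ^+ n).
Proof.
have K0 : 0 < cabs l + 1 by rewrite ltr_wpDl ?cabs_ge0.
apply: (superexp_small_dom ler01 K0) => n.
rewrite exprZn real_norm_scale cabsX mul1r ler_wpM2r ?real_norm_ge0 //.
by rewrite lerXn2r ?nnegrE ?(ltW K0) ?cabs_ge0 // lerDl.
Qed.

(** The partial sums of the Neumann series converge superexponentially fast. *)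
Lemma superexp_small_invertible x :
  superexp_small (fun n => x ^+ n) -> invertible (1 - x).
Proof.
move=> hx; pose z n := \sum_(k < n) x ^+ k.
have zr n : (1 - x) * z n = 1 - x ^+ n by rewrite -opprB mulNr -subrX1 opprB.
have zl n : z n * (1 - x) = 1 - x ^+ n.
  rewrite -zr /z mulr_suml mulr_sumr; apply: eq_bigr => k _.
  by rewrite mulrBr mulrBl mulr1 mul1r -exprSr -exprS.
have [|y hy] := @superexp_small_lim z.
  by apply: superexp_small_eq hx => n; rewrite /z big_ord_recr /= [_ + x ^+ n]addrC addrK.
exists y; split; apply/eqP; rewrite -subr_eq0; apply/eqP; apply: superexp_small_cst.
  apply: superexp_small_eq (superexp_smallD (superexp_smallMl (1 - x) hy)
    (superexp_smallN hx)) => n.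
  by rewrite mulrBr zr opprB addrA addrAC addrK.
apply: superexp_small_eq (superexp_smallD (superexp_smallMr (1 - x) hy)
  (superexp_smallN hx)) => n.
by rewrite mulrBl zl opprB addrA addrAC addrK.
Qed.

(** The value [0] does lie in the spectrum of [x] when the powers decay: if
    [y x = 1] then [1 = y ^ n x ^ n] would be superexponentially small. *)
Lemma quasinilpotentP x :
  quasinilpotent x <-> superexp_small (fun n => x ^+ n).
Proof.
split=> [qx|hx].
  apply: superexp_small_expr => l; have [->|l0] := eqVneq l 0.
    by exists 1; rewrite scale0r subr0 mulr1.
  have : ~ spectrum x l^-1 by rewrite qx /=; apply/eqP; rewrite invr_eq0.
  move=> /contrapT /(invertibleZ l0).
  by rewrite scalar_sub_factor ?invr_eq0 // invrK scalerA mulfV // scale1r.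
apply/seteqP; split => [l|_ ->] /=; rewrite /spectrum /=.
  move=> ninv; apply: contrapT => /eqP l0; apply: ninv.
  rewrite scalar_sub_factor //; apply: invertibleZ => //.
  exact/superexp_small_invertible/superexp_smallZX.
rewrite scale0r sub0r => -[y [_ yx]].
have yxn n : (- y) ^+ n * x ^+ n = 1.
  elim: n => [|n IH]; first by rewrite mulr1.
  by rewrite exprSr exprS -mulrA (mulrA (- y)) mulNr -mulrN yx mul1r.
have /superexp_small_cst/eqP : superexp_small (fun=> 1 : A).
  exact: superexp_small_eq (superexp_small_exprM (- y) hx).
by rewrite oner_eq0.
Qed.

End SpectralRadius.

(** * Spectral decomposition of an element with finite spectrum *)

Section Decomposition.
Context {R : realType} {A : banachAlgType R[i]}.
Context (a : A).
Implicit Types (w : A) (p q u v f g : {poly R[i]}).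

Local Notation ev := (horner_alg a).

(** Multiplying the identity at [(i, j + 1)] by [u p], the one at [(i + 1, j)]
    by [v q], and adding, yields the identity at [(i + 1, j + 1)].  The
    cofactors then obey a Pascal recursion, whence exponential growth. *)
Lemma bezout_powers p q u v : u * p + v * q = 1 ->
  exists2 K : R, 1 <= K & forall i j : nat, exists f g,
    [/\ p ^+ i * f + q ^+ j * g = 1,
        real_norm (ev f) <= real_norm (1 : A) * K ^+ (i + j) &
        real_norm (ev g) <= real_norm (1 : A) * K ^+ (i + j)].
Proof.
move=> bez.
pose K := 1 + (real_norm (ev u) + real_norm (ev (v * q))) +
  (real_norm (ev (u * p)) + real_norm (ev v)).
have K1 : 1 <= K by rewrite /K -addrA lerDl !addr_ge0 ?real_norm_ge0.
have K0 : 0 <= K := le_trans ler01 K1.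
have Kf : real_norm (ev u) + real_norm (ev (v * q)) <= K.
  by rewrite /K -addrA addrCA lerDl !addr_ge0 ?real_norm_ge0.
have Kg : real_norm (ev (u * p)) + real_norm (ev v) <= K.
  by rewrite /K lerDr !addr_ge0 ?real_norm_ge0.
have bnd (x1 x2 y1 y2 : A) (B : R) : 0 <= B ->
    real_norm y1 <= B -> real_norm y2 <= B ->
    real_norm (x1 * y1 + x2 * y2) <= B * (real_norm x1 + real_norm x2).
  move=> B0 y1B y2B; apply: le_trans (real_normD _ _) _.
  rewrite mulrDr; apply: lerD; apply: le_trans (real_normM _ _) _;
    by rewrite mulrC ler_wpM2r ?real_norm_ge0.
have N1 := @real_norm_ge0 R A 1.
exists K => // i j; have [m] := ubnP (i + j); elim: m i j => // m IH [|i] [|j] ijm.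
- exists 1, 0; rewrite expr0 mul1r mulr0 addr0 rmorph1 rmorph0 real_norm0.
  by split=> //; rewrite ?mulr_ge0 ?exprn_ge0 // ler_peMr // exprn_ege1.
- exists 1, 0; rewrite expr0 mul1r mulr0 addr0 rmorph1 rmorph0 real_norm0.
  by split=> //; rewrite ?mulr_ge0 ?exprn_ge0 // ler_peMr // exprn_ege1.
- exists 0, 1; rewrite expr0 mul1r mulr0 add0r rmorph1 rmorph0 real_norm0.
  by split=> //; rewrite ?mulr_ge0 ?exprn_ge0 // ler_peMr // exprn_ege1.
have [|f1 [g1 [e1 f1K g1K]]] := IH i j.+1; first by rewrite -ltnS.
have [|f2 [g2 [e2 f2K g2K]]] := IH i.+1 j; first by rewrite -ltnS -addnS.
rewrite addSnnS in f2K g2K.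
have B0 : 0 <= real_norm (1 : A) * K ^+ (i + j.+1) by rewrite mulr_ge0 ?exprn_ge0.
exists (u * f1 + v * q * f2), (u * p * g1 + v * g2); split.
- transitivity (u * p * (p ^+ i * f1 + q ^+ j.+1 * g1) +
    v * q * (p ^+ i.+1 * f2 + q ^+ j * g2)); first by rewrite !exprS; ring.
  by rewrite e1 e2 !mulr1.
- rewrite rmorphD /= (rmorphM _ u) (rmorphM _ (v * q)) addSn exprSr mulrA.
  by apply: le_trans (bnd _ _ _ _ _ B0 f1K f2K) _; rewrite ler_wpM2l.
- rewrite rmorphD /= (rmorphM _ (u * p)) (rmorphM _ v) addSn exprSr mulrA.
  by apply: le_trans (bnd _ _ _ _ _ B0 g1K g2K) _; rewrite ler_wpM2l.
Qed.

Lemma comm_horner_alg w p : GRing.comm a w -> GRing.comm (ev p) w.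
Proof.
move=> aw; rewrite -[p]coefK poly_def rmorph_sum /=.
apply/commr_sym/commr_sum => i _; rewrite linearZ /= rmorphXn /= horner_algX.
rewrite mulr_algl /GRing.comm -scalerAr -scalerAl; congr (_ *: _).
exact/commrX/commr_sym.
Qed.

(** With [p ^ n f n + q ^ n g n = 1], the component [w2] is the limit of
    [z n = p ^ n f n w].  The sequence is Cauchy because consecutive terms
    differ by [P' - P = P' (1 - P) - (1 - P') P], where [P = p ^ n f n] and
    [P' = p ^ n.+1 f n.+1]: each product is a multiple of [(p q) ^ n] with an
    exponentially bounded cofactor. *)
Lemma coprime_split w p q : GRing.comm a w -> coprimep p q ->
  superexp_small (fun n => ev (p * q) ^+ n * w) ->
  exists w1 w2, [/\ w = w1 + w2, GRing.comm a w1, GRing.comm a w2,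
    superexp_small (fun n => ev p ^+ n * w1) &
    superexp_small (fun n => ev q ^+ n * w2)].
Proof.
move=> aw /Bezout_eq1_coprimepP[[u v] /= bez] hw.
have [K K1 hK] := bezout_powers bez.
have K0 : 0 < K := lt_le_trans ltr01 K1.
have [f hf] := choice (fun n => hK n n).
have [g hg] := choice hf => {hf hK}.
have fg n : p ^+ n * f n + q ^+ n * g n = 1 by have [] := hg n.
pose c := real_norm (1 : A); have c0 : 0 <= c := real_norm_ge0 _.
have fK n : real_norm (ev (f n)) <= c * (K ^+ 2) ^+ n.
  by rewrite -exprM mul2n -addnn; have [] := hg n.
have gK n : real_norm (ev (g n)) <= c * (K ^+ 2) ^+ n.
  by rewrite -exprM mul2n -addnn; have [] := hg n.
have K20 : 0 < K ^+ 2 by rewrite exprn_gt0.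
have smallM (h : nat -> {poly R[i]}) (C L : R) : 0 <= C -> 0 < L ->
    (forall n, real_norm (ev (h n)) <= C * L ^+ n) ->
    superexp_small (fun n => ev (h n) * (ev (p * q) ^+ n * w)).
  move=> C0 L0 hL; apply: superexp_small_dom C0 L0 _ hw => n.
  by apply: le_trans (real_normM _ _) _; rewrite ler_wpM2r ?real_norm_ge0.
pose z n := ev (p ^+ n * f n) * w.
have [|w2 hw2] := @superexp_small_lim _ _ z.
  pose h n := p * f n.+1 * g n - q * g n.+1 * f n.
  pose C := (real_norm (ev p) + real_norm (ev q)) * (c * K ^+ 2 * c).
  apply: superexp_small_eq (smallM h C (K ^+ 2 * K ^+ 2) _ _ _) => [n|||n].
  - rewrite /z -mulrBl mulrA -rmorphXn -rmorphM -rmorphB /=; congr (ev _ * w).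
    have -> : p ^+ n.+1 * f n.+1 - p ^+ n * f n =
       p ^+ n.+1 * f n.+1 * (p ^+ n * f n + q ^+ n * g n) -
       (p ^+ n.+1 * f n.+1 + q ^+ n.+1 * g n.+1) * (p ^+ n * f n).
      by rewrite !fg mulr1 mul1r.
    by rewrite /h exprMn !exprS; ring.
  - by rewrite /C !mulr_ge0 ?addr_ge0 ?real_norm_ge0 ?(ltW K0).
  - by rewrite mulr_gt0.
  have B r s t : real_norm (ev s) <= c * (K ^+ 2) ^+ n.+1 ->
      real_norm (ev t) <= c * (K ^+ 2) ^+ n ->
      real_norm (ev (r * s * t)) <=
        real_norm (ev r) * (c * K ^+ 2 * c * (K ^+ 2 * K ^+ 2) ^+ n).
    move=> hs ht; rewrite !rmorphM; apply: le_trans (real_normM _ _) _.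
    have -> : real_norm (ev r) * (c * K ^+ 2 * c * (K ^+ 2 * K ^+ 2) ^+ n) =
      real_norm (ev r) * (c * (K ^+ 2) ^+ n.+1) * (c * (K ^+ 2) ^+ n).
      by rewrite (exprS (K ^+ 2)) exprMn; ring.
    apply: ler_pM; rewrite ?real_norm_ge0 //.
    by apply: le_trans (real_normM _ _) _; rewrite ler_wpM2l ?real_norm_ge0.
  rewrite /h rmorphB; apply: le_trans (real_normB _ _) _.
  by rewrite /C -[leRHS]mulrA [leRHS]mulrDl; apply: lerD; apply: B.
have pzE n : ev q ^+ n * z n = ev (f n) * (ev (p * q) ^+ n * w).
  rewrite /z mulrA mulrA -!rmorphXn -!rmorphM /=; congr (ev _ * w).
  by rewrite exprMn; ring.
have qzE n : ev p ^+ n * (w - z n) = ev (g n) * (ev (p * q) ^+ n * w).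
  rewrite /z -{1}[w]mul1r -[1](rmorph1 ev) -(fg n) -mulrBl rmorphD addrAC subrr add0r.
  rewrite mulrA mulrA -!rmorphXn -!rmorphM /=; congr (ev _ * w).
  by rewrite exprMn; ring.
have aw2 : GRing.comm a w2.
  apply/eqP; rewrite -subr_eq0; apply/eqP/superexp_small_cst.
  apply: superexp_small_eq (superexp_smallD (superexp_smallMl a hw2)
    (superexp_smallN (superexp_smallMr a hw2))) => n.
  have : GRing.comm a (z n).
    by apply: commrM => //; apply/commr_sym/comm_horner_alg.
  by rewrite mulrBr mulrBl => <-; rewrite opprB addrA subrK.
exists (w - w2), w2; split=> //; first by rewrite subrK.
- exact: commrB.
- apply: superexp_small_eq (superexp_smallD (smallM g _ _ c0 K20 gK)
    (superexp_smallN (superexp_small_exprM (ev p) hw2))) => n.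
  by rewrite -qzE -mulrBr opprB addrA subrK.
- apply: superexp_small_eq (superexp_smallD (smallM f _ _ c0 K20 fK)
    (superexp_small_exprM (ev q) hw2)) => n.
  by rewrite -pzE -mulrDr addrC subrK.
Qed.

Lemma evZ m p : ev (m *: p) = m *: ev p.
Proof. by rewrite linearZ /= mulr_algl. Qed.

Lemma ev_XsubC l : ev ('X - l%:P) = a - l%:A.
Proof. by rewrite rmorphB /= horner_algX horner_algC. Qed.

(** The [P l] are the Riesz components of [w]; they are split off one root at
    a time. *)
Lemma root_decomposition (s : seq R[i]) w : uniq s -> GRing.comm a w ->
  superexp_small (fun n => ev (\prod_(l <- s) ('X - l%:P)) ^+ n * w) ->
  exists P : R[i] -> A, [/\ w = \sum_(l <- s) P l, forall l, GRing.comm a (P l) &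
    forall l, superexp_small (fun n => (a - l%:A) ^+ n * P l)].
Proof.
elim: s w => [|l s IH] w /= => [_ _|/andP[ls us] aw].
  under eq_fun do rewrite big_nil rmorph1 expr1n mul1r.
  move=> /superexp_small_cst ->; exists (fun=> 0).
  split=> [|l|l]; [by rewrite big_nil | exact: commr0 |].
  by move=> e _; exists 0 => n; rewrite mulr0 mul0r real_norm0.
rewrite big_cons => hw.
have cop : coprimep ('X - l%:P) (\prod_(m <- s) ('X - m%:P)).
  by rewrite coprimep_sym coprimep_XsubC root_prod_XsubC.
have [w1 [w2 [-> aw1 aw2 hw1 hw2]]] := coprime_split aw cop hw.
have [P [sP aP hP]] := IH w2 us aw2 hw2.
exists (fun m => if m == l then w1 else P m); split=> [|m|m].
- rewrite big_cons eqxx sP; congr (_ + _); apply: eq_big_seq => m ms.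
  by case: eqP ms ls => // -> ->.
- by case: eqP.
- by case: eqP => [->|_] //; rewrite -ev_XsubC.
Qed.

(** Spectral mapping: for [m != 0] the roots of [1 - m q] are not roots of [q],
    hence lie outside the spectrum, and [1 - m q(a)] is a product of invertible
    factors. *)
Lemma finite_spectrum_expr_small : finite_set (spectrum a) ->
  exists2 s : seq R[i], uniq s &
    superexp_small (fun n => ev (\prod_(l <- s) ('X - l%:P)) ^+ n).
Proof.
(* Adding [0] keeps [q] from being constant, so that [1 - m q] is never zero. *)
move=> /finite_seqP[s0 sE]; pose s := undup (0 :: s0).
have s_inv l : l \notin s -> invertible (l%:A - a).
  rewrite mem_undup inE negb_or => /andP[_ ls]; apply: contrapT => nl.
  by move/negP: ls; apply; change ([set` s0] l); rewrite -sE.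
exists s; first exact: undup_uniq.
set q := \prod_(l <- s) _; apply: superexp_small_expr => m.
have [->|m0] := eqVneq m 0; first by rewrite scale0r subr0; apply: invertible1.
have -> : 1 - m *: ev q = ev (1 - m *: q).
  by rewrite rmorphB rmorph1; congr (_ - _); exact/esym/evZ.
have P0 : 1 - m *: q != 0.
  apply/eqP => /(congr1 (fun p : {poly _} => p + m *: q)).
  rewrite subrK add0r => /(congr1 (size \o polyseq)) /=.
  rewrite size_scale // size_prod_XsubC size_poly1 => -[] /esym/eqP.
  rewrite size_eq0 => /eqP s_nil.
  by have : 0 \in s by [rewrite mem_undup inE eqxx]; rewrite s_nil.
have [r Dr] := closed_field_poly_normal (1 - m *: q).
rewrite Dr evZ; apply: invertibleZ; first by rewrite lead_coef_eq0.
have : all (root (1 - m *: q)) r.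
  apply/allP => l lr; rewrite Dr rootZ ?lead_coef_eq0 //.
  by rewrite root_prod_XsubC.
elim: r {Dr} => [|l r IH] /=; first by rewrite big_nil rmorph1 => _; apply: invertible1.
move=> /andP[rl rr]; rewrite big_cons rmorphM; apply: invertibleM; last exact: IH.
rewrite /= ev_XsubC -opprB; apply: invertibleN.
apply: s_inv; apply/negP => ls; move: rl.
have : root q l by rewrite root_prod_XsubC.
rewrite /root !hornerE => /eqP ->.
by rewrite mulr0 subr0 oner_eq0.
Qed.

End Decomposition.

(** * Commutator iterates *)

Section Radius.
Context {R : realType} {A : banachAlgType R[i]}.
Implicit Types (a b x y : A).

Definition commutator_iter a b n : A := iter n (commutator_op a b) 1.

Lemma local_radius_ge0 a b : (0 <= local_radius a b)%E.
Proof.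
apply: limf_esup_ge0 => [|n]; last by rewrite lee_fin powR_ge0.
by move=> [n _] /(_ n (leqnn n)).
Qed.

Lemma local_radius_le0P a b :
  (local_radius a b <= 0)%E <-> superexp_small (commutator_iter a b).
Proof.
rewrite /local_radius /limn_esup limf_esupE; split.
  move=> h; apply/superexp_smallP => e e0.
  have he : (ereal_inf [set ereal_sup [set (real_norm
      (iter n (commutator_op a b) 1) `^ n%:R^-1)%:E | n in V]
      | V in \oo] < e%:E)%E by apply: le_lt_trans h _; rewrite lte_fin.
  have [_ [V [n0 _ n0V] <-] hV] := ereal_inf_lt he.
  exists n0.+1 => -[|n] // n0n.
  have : ((real_norm (commutator_iter a b n.+1) `^ n.+1%:R^-1)%:E <= e%:E)%E.
    apply: le_trans (ltW hV); apply: ereal_sup_ubound; exists n.+1 => //.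
    by apply: n0V; apply: leq_trans n0n.
  rewrite lee_fin => hn.
  have -> : real_norm (commutator_iter a b n.+1) =
      (real_norm (commutator_iter a b n.+1) `^ n.+1%:R^-1) ^+ n.+1.
    rewrite -powR_mulrn ?powR_ge0 // -powRrM mulVf ?pnatr_eq0 //.
    by rewrite powRr1 // real_norm_ge0.
  by rewrite lerXn2r ?nnegrE ?powR_ge0 ?(ltW e0).
move=> /superexp_smallP hs; apply/lee_addgt0Pr => e e0; rewrite add0e.
have [n0 hn0] := hs e e0.
pose V := [set n | (n0.+1 <= n)%N].
apply: ereal_inf_le.
exists (ereal_sup [set (real_norm (iter n (commutator_op a b) 1) `^ n%:R^-1)%:E
  | n in V]); first by exists V => //; exists n0.+1.
apply: ge_ereal_sup => _ [[|n] //= n0n <-]; rewrite lee_fin.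
have -> : e = (e ^+ n.+1) `^ n.+1%:R^-1.
  rewrite -powR_mulrn ?(ltW e0) // -powRrM mulfV ?pnatr_eq0 //.
  by rewrite powRr1 // ltW.
rewrite ge0_ler_powR ?nnegrE ?real_norm_ge0 ?exprn_ge0 ?(ltW e0) ?invr_ge0 //.
exact: hn0 (ltnW n0n).
Qed.

Lemma spectral_dist_eq0P a b : spectral_dist a b = 0%E <->
  superexp_small (commutator_iter a b) /\ superexp_small (commutator_iter b a).
Proof.
rewrite -!local_radius_le0P /spectral_dist; split=> [h|[hab hba]].
  by split; rewrite -h le_max lexx ?orbT.
by apply/eqP; rewrite eq_le ge_max hab hba le_max local_radius_ge0.
Qed.

(** On the products [ra ^ j rb ^ k] the two operators agree:
    [a ra^j rb^k - ra^j rb^k b = ra^j (a - b) rb^k = ra^j (ra - rb) rb^k]. *)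
Lemma commutator_iter_conj a b ra rb :
  GRing.comm ra a -> GRing.comm rb b -> a - b = ra - rb ->
  superexp_small (fun n => ra ^+ n) -> superexp_small (fun n => rb ^+ n) ->
  superexp_small (commutator_iter a b).
Proof.
move=> ca cb abE ha hb.
pose C := commutator_op a b.
have iterB m x y : iter m C (x - y) = iter m C x - iter m C y.
  elim: m => //= m ->; rewrite /C /commutator_op mulrBr mulrBl.
  by rewrite !opprB addrACA [- _ + _]addrC -!addrA; congr (_ + _);
     rewrite addrCA.
pose s j k m := iter m C (ra ^+ j * rb ^+ k).
have -> : commutator_iter a b = s 0%N 0%N by apply/funext => m; rewrite /s mul1r.
apply: (@pascal_small _ _ s (fun j => ra ^+ j) (fun k => rb ^+ k) 1) => //.
  move=> j k m; rewrite /s iterSr.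
  have -> : C (ra ^+ j * rb ^+ k) = ra ^+ j.+1 * rb ^+ k - ra ^+ j * rb ^+ k.+1.
    have caj : GRing.comm a (ra ^+ j) by apply/commrX/commr_sym.
    have cbk : GRing.comm b (rb ^+ k) by apply/commrX/commr_sym.
    rewrite /C /commutator_op mulrA caj -!mulrA -cbk -mulrBr -mulrBl abE.
    by rewrite mulrBl mulrBr exprSr -mulrA exprS.
  by rewrite iterB real_normB.
by move=> j k; rewrite mul1r real_normM.
Qed.

(** Right multiplication by [b - l] is left multiplication by [a - l] minus
    [C_{a,b}], and these two operators commute.  The powers of each, applied to
    [P], decay: those of [C_{a,b}] because [C_{a,b} ^ n P = P C_{a,b} ^ n 1]. *)
Lemma commutator_small_right a b P l : GRing.comm a P ->
  superexp_small (commutator_iter a b) ->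
  superexp_small (fun n => (a - l%:A) ^+ n * P) ->
  superexp_small (fun n => P * (b - l%:A) ^+ n).
Proof.
move=> aP hab hP.
pose s j k m := (a - l%:A) ^+ j * P * commutator_iter a b k * (b - l%:A) ^+ m.
have -> : (fun n => P * (b - l%:A) ^+ n) = s 0%N 0%N.
  by apply/funext => n; rewrite /s mul1r mulr1.
apply: (@pascal_small _ _ s (fun j => (a - l%:A) ^+ j * P)
  (commutator_iter a b) 1) => // [j k m|j k]; last first.
  by rewrite /s mulr1 mul1r real_normM.
suff -> : s j k m.+1 = s j.+1 k m - s j k.+1 m by apply: real_normB.
have PlE : (a - l%:A) * P = P * (a - l%:A).
  by rewrite mulrBl mulrBr aP mulr_algl mulr_algr.
rewrite /s exprS [in RHS]exprSr -!mulrA -mulrBr; congr (_ * _).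
rewrite (mulrA (a - _)) PlE -mulrA -mulrBr; congr (_ * _).
rewrite !mulrA -mulrBl; congr (_ * _).
rewrite /commutator_iter iterS /commutator_op; set D := iter _ _ _.
rewrite mulrBr mulrBl mulr_algr mulr_algl opprB addrA.
by rewrite [RHS]addrAC (addrAC (a * D)) subrr add0r addrC.
Qed.

Lemma commutator_small_left a b P l : GRing.comm a P ->
  superexp_small (commutator_iter b a) ->
  superexp_small (fun n => (a - l%:A) ^+ n * P) ->
  superexp_small (fun n => (b - l%:A) ^+ n * P).
Proof.
move=> aP hba hP.
pose s j k m := (b - l%:A) ^+ m * commutator_iter b a k * ((a - l%:A) ^+ j * P).
have -> : (fun n => (b - l%:A) ^+ n * P) = s 0%N 0%N.
  by apply/funext => n; rewrite /s mul1r mulr1.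
apply: (@pascal_small _ _ s (fun j => (a - l%:A) ^+ j * P)
  (commutator_iter b a) 1) => // [j k m|j k]; last first.
  by rewrite /s !mul1r mulrC real_normM.
suff -> : s j k m.+1 = s j.+1 k m + s j k.+1 m by apply: real_normD.
rewrite /s exprSr (exprS (a - _)) -!mulrA -mulrDr; congr (_ * _).
rewrite !mulrA -!mulrDl; congr (_ * _ * _).
rewrite /commutator_iter iterS /commutator_op; set D := iter _ _ _.
rewrite mulrBr mulrBl mulr_algr mulr_algl.
by rewrite [RHS]addrC addrA subrK.
Qed.

(** As [y] commutes with [b],
    [(l - m) ^ n P y Q = P ((b - m) - (b - l)) ^ n y Q]; in the binomial
    expansion the powers of [b - l] can be moved next to [P] and those of
    [b - m] next to [Q], so the right-hand side is superexponentially small. *)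
Lemma spectral_separation b P Q y l m : l != m -> GRing.comm b y ->
  superexp_small (fun n => P * (b - l%:A) ^+ n) ->
  superexp_small (fun n => (b - m%:A) ^+ n * Q) ->
  P * y * Q = 0.
Proof.
move=> lm bY hP hQ.
pose s j k n := (l - m) ^+ n *: (P * (b - l%:A) ^+ j * y * ((b - m%:A) ^+ k * Q)).
have lm0 : 0 < cabs (l - m) by rewrite cabs_gt0 // subr_eq0.
apply: (@superexp_small_eq0 _ _ (s 0%N 0%N) _ _ lm0).
  by move=> n; rewrite /s mulr1 mul1r real_norm_scale cabsX.
apply: (@pascal_small _ _ s _ _ (real_norm y) _ _ hP hQ) => [j k n|j k]; last first.
  rewrite /s scale1r; apply: le_trans (real_normM _ _) _.
  rewrite ler_wpM2r ?real_norm_ge0 // mulrC; exact: real_normM.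
suff -> : s j k n.+1 = s j k.+1 n - s j.+1 k n.
  by rewrite [leRHS]addrC; apply: real_normB.
rewrite /s exprSr -scalerA -scalerBr; congr (_ *: _).
have yE : y * (b - m%:A) - (b - l%:A) * y = (l - m) *: y.
  rewrite mulrBr mulrBl bY mulr_algr mulr_algl opprB.
  by rewrite addrC addrA subrK scalerBl.
rewrite exprS exprSr -!mulrA -mulrBr scalerAr; congr (_ * _).
rewrite -mulrBr scalerAr; congr (_ * _).
by rewrite scalerAl -yE mulrBl !mulrA.
Qed.

(** Subtracting [\sum_l l P l] shifts [x] by [l] on the range of [P l], for all
    [l] at once. *)
Lemma scalar_shift_small (s : seq R[i]) (P : R[i] -> A) x : uniq s ->
  1 = \sum_(l <- s) P l ->
  (forall l m, l != m -> P l * P m = 0) ->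
  (forall l, l \in s -> GRing.comm x (P l)) ->
  (forall l, superexp_small (fun n => (x - l%:A) ^+ n * P l)) ->
  superexp_small (fun n => (x - \sum_(l <- s) l *: P l) ^+ n).
Proof.
move=> us sP PP xP hx; set c := \sum_(l <- s) _.
apply: superexp_small_eq (superexp_small_sum s hx) => n.
rewrite -[RHS]mulr1 [X in _ = _ * X]sP mulr_sumr; apply: eq_big_seq => l ls.
have cP : c * P l = l *: P l.
  have PPl : P l * P l = P l.
    rewrite -[RHS]mul1r sP mulr_suml (bigD1_seq l) //= big1 ?addr0 // => m ml.
    exact: PP.
  rewrite /c mulr_suml (bigD1_seq l) //= big1 ?addr0 => [|m ml].
    by rewrite -scalerAl PPl.
  by rewrite -scalerAl PP // scaler0.
elim: n => [|n IH] //.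
rewrite !exprSr -!mulrA.
have -> : (x - c) * P l = P l * (x - l%:A).
  by rewrite mulrBl cP mulrBr mulr_algr xP.
rewrite (mulrA _ (P l)) -IH -mulrA; congr (_ * _).
by rewrite mulrBl mulrBr mulr_algr mulr_algl xP.
Qed.

End Radius.

Theorem theorem4p3 (R : realType) (A : banachAlgType R[i]) (a b : A)
    (fin_sa : finite_set (spectrum a)) :
  spectral_dist a b = 0%E <->
  exists ra rb : A,
    [/\ quasinilpotent ra, quasinilpotent rb,
        ra * a = a * ra, rb * b = b * rb & a - b = ra - rb].
Proof.
rewrite spectral_dist_eq0P; split; last first.
  move=> [ra [rb [/quasinilpotentP ha /quasinilpotentP hb ca cb abE]]].
  split; first exact: commutator_iter_conj ca cb abE ha hb.
  by apply: commutator_iter_conj cb ca _ hb ha; rewrite -opprB abE opprB.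
move=> [hab hba].
have [s us hs] := finite_spectrum_expr_small fin_sa.
have [|P [sP aP hP]] := root_decomposition us (commr1 a).
  by apply: superexp_small_eq hs => n; rewrite mulr1.
have hPb l := commutator_small_right (aP l) hab (hP l).
have hbP l := commutator_small_left (aP l) hba (hP l).
have hPa l : superexp_small (fun n => P l * (a - l%:A) ^+ n).
  apply: superexp_small_eq (hP l) => n; apply/commr_sym/commrX.
  by apply: commrB; [exact/commr_sym/aP | rewrite /GRing.comm mulr_algl mulr_algr].
have PP l m : l != m -> P l * P m = 0.
  move=> lm; rewrite -[P l]mulr1.
  exact: spectral_separation lm (commr1 a) (hPa l) (hP m).
have PbP l m : l != m -> P l * b * P m = 0.
  by move=> lm; apply: spectral_separation lm (commr_refl b) (hPb l) (hbP m).
have bP l : l \in s -> GRing.comm b (P l).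
  move=> ls; transitivity (P l * b * P l).
    rewrite -[LHS]mul1r sP mulr_suml (bigD1_seq l) //= big1 ?addr0 ?mulrA // => m ml.
    by rewrite mulrA PbP.
  rewrite -[RHS]mulr1 [X in _ = _ * X]sP mulr_sumr (bigD1_seq l) //=.
  rewrite big1 ?addr0 // => m ml.
  by rewrite PbP // eq_sym.
pose c := \sum_(l <- s) l *: P l.
have comm_c x : (forall l, l \in s -> GRing.comm x (P l)) -> GRing.comm x c.
  move=> xP; rewrite /c big_seq; apply: commr_sum => l /xP xPl.
  by rewrite /GRing.comm -scalerAr -scalerAl xPl.
have ac : GRing.comm a c by apply: comm_c => l _; apply: aP.
have bc : GRing.comm b c by apply: comm_c.
exists (a - c), (b - c); split.
- apply/quasinilpotentP; apply: scalar_shift_small => // l _; exact: aP.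
- by apply/quasinilpotentP; apply: scalar_shift_small.
- by rewrite mulrBl mulrBr ac.
- by rewrite mulrBl mulrBr bc.
- by rewrite opprB addrA subrK.
Qed.
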